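(* Let $\omega_0=m+n\omega$ with $m,n\in\mathbb{Z}$, $\gcd(m,n)=1$ and $n$ odd, and let $\gamma$ be the primitive closed geodesic of $2\Delta$ parametrized by $t\mapsto\pi\left(\frac12+t\omega_0\right)$ (with $t\in[0,1]$ if $\omega_0\in Hex$ and $t\in[0,3]$ if $\omega_0\notin Hex$). Then $$\operatorname{length}\gamma=\begin{cases}|\omega_0|, & \text{if } \omega_0\in Hex,\\ 3|\omega_0|, & \text{if } \omega_0\notin Hex.\end{cases}$$
   Context: Let $\omega=\exp(2\pi i/6)$ and $\Lambda_{1,\omega}=\mathbb{Z}+\mathbb{Z}\omega\subset\mathbb{C}$. Let $\Delta$ be the Euclidean equilateral triangle with vertices $0,1,\omega$, decorated with $\circ,\bullet,\ast$ respectively. $2\Delta$ is the sphere obtained by gluing $\Delta$ and its complex conjugate $\bar\Delta$ along their boundaries via $z\mapsto\bar z$, with its flat metric with conic singularities at the three vertices. Let $\Gamma_{3,3,3}$ be the group generated by the rotations of angle $2\pi/3$ about $0,1,\omega$; then $2\Delta=\mathbb{C}/\Gamma_{3,3,3}$, and $\pi:\mathbb{C}\to 2\Delta$ is the natural projection. $Hex=\langle 2-\omega,\,1+\omega\rangle$ is the sub-lattice of $\Lambda_{1,\omega}$ of vertices decorated $\circ$ in the $\Gamma_{3,3,3}$-invariant decorated tessellation of $\mathbb{C}$ by unit equilateral triangles, equivalently the lattice of translations in $\Gamma_{3,3,3}$. Primitive means not a proper iterate of a shorter closed geodesic. *)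

(* Defs.v *)
(* The reals are an arbitrary [R : realType], and the
   complex numbers are [R[i]] from mathcomp-real-closed. *)
From mathcomp Require Export all_boot all_order all_algebra.
From mathcomp Require Export generic_quotient complex.
From mathcomp Require Export all_classical all_reals all_analysis.

Set Implicit Arguments.
Unset Strict Implicit.
Unset Printing Implicit Defensive.

Import Order.TTheory GRing.Theory Num.Theory.
Import ComplexField.Normc.

Local Open Scope classical_set_scope.
Local Open Scope ring_scope.
Local Open Scope complex_scope.
Local Open Scope quotient_scope.

Section Plane.
Variable R : realType.
Local Notation C := R[i].

(* exp (i theta) *)
Definition cis (theta : R) : C := cos theta +i* sin theta.

Definition omega : C := cis (2 * pi / 6).

Definition rotation (c : C) (theta : R) (z : C) : C := c + cis theta * (z - c).

Definition transformation_group (G : set (C -> C)) : Prop :=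
  [/\ G id,
      forall f, G f -> bijective f,
      forall f g, G f -> G g -> G (f \o g) &
      forall f g, G f -> cancel f g -> cancel g f -> G g].

Definition vertices : set C := [set 0; 1; omega].

(* [smallest P S] is the intersection of all sets containing S and satisfying
   P, so this is the group generated by the three rotations. *)
Definition Gamma333 : set (C -> C) :=
  smallest transformation_group
    [set rotation c (2 * pi / 3) | c in vertices].

Definition Hex : set C :=
  [set z | exists a b : int, z = a%:~R * (2 - omega) + b%:~R * (1 + omega)].

(* The closed filled triangle, in barycentric coordinates. *)
Definition Delta : set C :=
  [set z | exists a b c : R, [/\ 0 <= a, 0 <= b, 0 <= c, a + b + c = 1 &
                                 z = a%:C * 0 + b%:C * 1 + c%:C * omega]].

Definition Delta_bar : set C := [set z^* | z in Delta].

Definition segment (u v : C) : set C :=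
  [set u + t%:C * (v - u) | t in [set t : R | 0 <= t <= 1]].

Definition Delta_boundary : set C :=
  segment 0 1 `|` segment 1 omega `|` segment omega 0.

(* The disjoint union of the two triangles, before gluing. *)
Definition sheets : Type := (Delta + Delta_bar)%type.

Definition position (x : sheets) : C :=
  match x with inl z => val z | inr z => val z end.

(* The point of Delta facing x: identity on Delta, conjugation on Delta_bar. *)
Definition fold_sheets (x : sheets) : C :=
  match x with inl z => val z | inr z => (val z)^* end.

(* The equivalence relation generated by identifying each z of the boundary of
   Delta with its conjugate in Delta_bar. *)
Definition glue : rel sheets := fun x y =>
  (x == y) ||
  ((fold_sheets x == fold_sheets y) && `[< Delta_boundary (fold_sheets x) >]).

Lemma glue_refl : reflexive glue.
Proof. by move=> x; rewrite /glue eqxx. Qed.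

Lemma glue_sym : symmetric glue.
Proof.
move=> x y; rewrite /glue [y == x]eq_sym [fold_sheets y == _]eq_sym.
by case: (x == y) => //=; case: eqP => // ->.
Qed.

Lemma glue_trans : transitive glue.
Proof.
move=> y x z; rewrite /glue => /orP[/eqP -> //|/andP[/eqP xy bx]].
case/orP => [/eqP <-|/andP[/eqP yz _]]; rewrite xy ?eqxx -xy bx ?orbT//.
by rewrite xy yz eqxx orbT.
Qed.

Canonical glue_equiv : equiv_rel sheets := EquivRel glue glue_refl glue_sym glue_trans.

(* The glued sphere 2 Delta. *)
Definition Double : Type := {eq_quot glue_equiv}.

Definition glue_class (x : sheets) : Double := \pi_({eq_quot glue_equiv}) x.

Definition cone_point : set Double :=
  [set glue_class x | x in [set x | vertices (fold_sheets x)]].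

(* Euclidean distance on each sheet; distinct sheets are infinitely far apart
   before gluing. *)
Definition sheet_dist (x y : sheets) : \bar R :=
  match x, y with
  | inl z, inl w => (normc (val z - val w))%:E
  | inr z, inr w => (normc (val z - val w))%:E
  | _, _ => +oo%E
  end.

(* s = [:: (x1, y1); ...; (xk, yk)] with p = [x1], [yi] = [x(i+1)], [yk] = q *)
Fixpoint chain (p : Double) (s : seq (sheets * sheets)) (q : Double) : Prop :=
  match s with
  | [::] => p = q
  | xy :: s' => glue_class xy.1 = p /\ chain (glue_class xy.2) s' q
  end.

(* The flat metric of the sphere: the usual quotient metric of a gluing, i.e.
   the infimum of the total lengths of the chains from p to q. *)
Definition double_dist (p q : Double) : \bar R :=
  ereal_inf [set (\sum_(xy <- s) sheet_dist xy.1 xy.2)%E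
            | s in [set s | chain p s q]].

(* Metric length of a curve restricted to [a, b]; compare [variation]. *)
Definition curve_length (a b : R) (gamma : R -> Double) : \bar R :=
  ereal_sup [set (\sum_(0 <= k < size s)
                    double_dist (gamma (nth b (a :: s) k))
                                (gamma (nth b (a :: s) k.+1)))%E
            | s in itv_partition a b].

(* Constant-speed geodesic line of the flat surface punctured at its cone
   points: locally distance-preserving, up to the speed v. *)
Definition geodesic (gamma : R -> Double) : Prop :=
  (forall t, ~ cone_point (gamma t)) /\
  exists2 v : R, 0 < v &
    forall t, exists2 e : R, 0 < e &
      forall s s', `|s - t| < e -> `|s' - t| < e ->
        double_dist (gamma s) (gamma s') = (v * `|s - s'|)%:E.

(* A closed geodesic parametrized by [0, T], as a T-periodic geodesic line. *)
Definition closed_geodesic (T : R) (gamma : R -> Double) : Prop :=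
  [/\ 0 < T, geodesic gamma & forall t, gamma (t + T) = gamma t].

(* [gamma], run over [0, T], is the k-th iterate of [sigma], run over [0, S] *)
Definition iterate_of (k : nat) (S : R) (sigma : R -> Double)
    (T : R) (gamma : R -> Double) : Prop :=
  forall t, gamma t = sigma (k%:R * S * (t / T)).

Definition primitive_closed_geodesic (T : R) (gamma : R -> Double) : Prop :=
  closed_geodesic T gamma /\
  ~ exists (k : nat) (S : R) (sigma : R -> Double),
      [/\ (1 < k)%N, closed_geodesic S sigma & iterate_of k S sigma T gamma].

Lemma Delta0 : (0 : C) \in Delta.
Proof.
by rewrite inE; exists 1, 0, 0; split; rewrite ?ler01 ?addr0// !mul0r mulr0 !addr0.
Qed.

(* The natural projection C -> C / Gamma333 = 2 Delta: the class of any point of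
   Delta or Delta_bar lying in the Gamma333-orbit of z. The union of Delta and
   Delta_bar is a fundamental domain and [glue] is the identification of its
   points by Gamma333, so such a point exists (the default value is never used)
   and its class does not depend on the choice. *)
Definition natproj (z : C) : Double :=
  glue_class (xget (inl (exist _ (0 : C) Delta0) : sheets)
    [set x | exists2 g, Gamma333 g & position x = g z]).

End Plane.

Arguments omega {R}.

(* Main.v *)
(* Gamma333 consists of the maps z |-> omega^(2j) z + h with h in Hex. A
   chain of segments in the two sheets lifts to a broken line of the same
   length in C, so the distance of two projected points is at least the
   Euclidean distance of their orbits; conversely a segment is cut by the
   tessellation into pieces that project isometrically. As n is odd, the
   line 1/2 + t omega0 stays at distance at least 1 / (4 |omega0|) from the
   lattice: a rotation in Gamma333 therefore moves its points away by a
   fixed amount, and the projection is isometric on short arcs of the line,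
   all of the same size. This gives geodesicity and the length |omega0| T.
   Finally a period T' of the projected line must come from a translation,
   i.e. T' omega0 is in Hex, which for gcd (m, n) = 1 means that T' is a
   multiple of T. *)
Require Import Defs.
From mathcomp Require Import ring lra zify.
Import Order.TTheory GRing.Theory Num.Theory.
Import ComplexField.Normc.

Set Implicit Arguments.
Unset Strict Implicit.
Unset Printing Implicit Defensive.

Local Open Scope classical_set_scope.
Local Open Scope ring_scope.
Local Open Scope complex_scope.

(** * Arithmetic of the Eisenstein integers and of the sub-lattice [Hex] *)

Section Eisenstein.
Context {R : realType}.
Local Notation C := R[i].
Implicit Types (x y : R) (z w : C).

Lemma cisD (a b : R) : cis (a + b) = cis a * cis b.
Proof.
rewrite /cis cosD sinD; apply/eqP; rewrite eq_complex /=.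
by apply/andP; split; apply/eqP; ring.
Qed.

(** For a = pi / 3, the triple-angle formulas with sin (3 a) = 0 and sin a > 0 force 4 cos^2 a = 1;
    cos (3 a) = -1 then selects the positive root. *)
Lemma cos_pi3 : cos (2 * pi / 6) = 1 / 2 :> R.
Proof.
set a : R := 2 * pi / 6.
have a3 : a + a + a = pi by rewrite /a; field.
have s0 : 0 < sin a.
  by apply: sin_gt0_pi; rewrite /a; have := pi_gt0 R; lra.
have := cos2Dsin2 a.
have : cos (a + a + a) = -1 by rewrite a3 cospi.
have : sin (a + a + a) = 0 by rewrite a3 sinpi.
rewrite !cosD !sinD !cosD.
move: (cos a) (sin a) s0 => c s s0 es ec e1.
have h : s * (4 * c ^+ 2 - 1) = 0.
  rewrite -es; have -> : 4 * c ^+ 2 - 1 = 3 * c ^+ 2 - s ^+ 2 + ((c ^+ 2 + s ^+ 2) - 1) by ring.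
  by rewrite e1; ring.
have {}h : 4 * c ^+ 2 - 1 = 0.
  by apply/eqP; move/eqP: h; rewrite mulf_eq0 gt_eqF.
have {}ec : c * (4 * c^+2 - 3) = -1.
  rewrite -ec; have -> : s * (s) = 1 - c^+2 by rewrite -e1; ring.
  have -> : 4 * c ^+ 2 - 3 = c ^+ 2 - 3 * (1 - c ^+ 2) by ring.
  have -> : 1 - c ^+ 2 = s ^+ 2 by rewrite -e1; ring.
  ring.
have h2 : 4 * c ^+ 2 = 1 by lra.
by move: ec; rewrite h2; lra.
Qed.

Lemma sin_pi3_gt0 : 0 < sin (2 * pi / 6) :> R.
Proof. by apply: sin_gt0_pi; have := pi_gt0 R; lra. Qed.

Lemma sin_pi3_sq : sin (2 * pi / 6) ^+ 2 = 3 / 4 :> R.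
Proof. by rewrite sin2cos2 cos_pi3; field. Qed.

(** Coordinates in the real basis (1, omega): products, conjugation and the squared norm become
    polynomial, and lattice points are those with integer coordinates. *)
Definition lc (x y : R) : C := x%:C + y%:C * omega.

Lemma lcE x y : lc x y = (x + y / 2) +i* (y * sin (2 * pi / 6)).
Proof.
rewrite /lc /omega /cis cos_pi3; apply/eqP; rewrite eq_complex /=.
by apply/andP; split; apply/eqP; field.
Qed.

Lemma omega2 : omega ^+ 2 = omega - 1 :> C.
Proof.
rewrite /omega /cis cos_pi3; apply/eqP; rewrite eq_complex /=.
have := sin_pi3_sq; move: (sin _) => s; rewrite expr2 => ->.
by apply/andP; split; apply/eqP; field.
Qed.

Lemma omega3 : omega ^+ 3 = -1 :> C.
Proof. by rewrite exprS omega2 mulrBr -expr2 omega2; ring. Qed.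

Lemma omega4 : omega ^+ 4 = - omega :> C.
Proof. by rewrite exprS omega3 mulrN1. Qed.

Lemma lc_surj z : exists x y, z = lc x y.
Proof.
case: z => a b; pose y := b / sin (2 * pi / 6).
exists (a - y / 2), y; rewrite lcE subrK /y divfK // gt_eqF //.
exact: sin_pi3_gt0.
Qed.

Lemma lc_inj x y x' y' : lc x y = lc x' y' -> x = x' /\ y = y'.
Proof.
rewrite !lcE => -[e1 e2].
have ey : y = y' by apply: (mulIf _ e2); rewrite gt_eqF // sin_pi3_gt0.
by split=> //; move: e1; rewrite ey => /addIr.
Qed.

Lemma lcD x y x' y' : lc x y + lc x' y' = lc (x + x') (y + y').
Proof. by rewrite /lc !rmorphD /=; ring. Qed.

Lemma lcN x y : - lc x y = lc (- x) (- y).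
Proof. by rewrite /lc !rmorphN /=; ring. Qed.

Lemma lcB x y x' y' : lc x y - lc x' y' = lc (x - x') (y - y').
Proof. by rewrite lcN lcD. Qed.

Lemma lcM x y x' y' :
  lc x y * lc x' y' = lc (x * x' - y * y') (x * y' + y * x' + y * y').
Proof.
rewrite /lc !rmorphD rmorphN !rmorphM /=.
by ring: omega2.
Qed.

Lemma conj_lc x y : (lc x y)^* = lc (x + y) (- y).
Proof.
rewrite !lcE; apply/eqP; rewrite eq_complex /=.
by apply/andP; split; apply/eqP; field.
Qed.

Lemma real_lc x : x%:C = lc x 0.
Proof. by rewrite /lc rmorph0 mul0r addr0. Qed.

Lemma omega_lc : omega = lc 0 1.
Proof. by rewrite /lc rmorph0 rmorph1 mul1r add0r. Qed.

Lemma one_lc : 1 = lc 1 0.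
Proof. by rewrite -real_lc rmorph1. Qed.

Lemma omega2_lc x y : omega ^+ 2 * lc x y = lc (- x - y) x.
Proof. by rewrite omega2 omega_lc one_lc lcB lcM; congr lc; ring. Qed.

Lemma omega4_lc x y : omega ^+ 4 * lc x y = lc y (- x - y).
Proof. by rewrite omega4 omega_lc lcN lcM; congr lc; ring. Qed.

Lemma normc_lc x y : normc (lc x y) ^+ 2 = x ^+ 2 + x * y + y ^+ 2.
Proof.
rewrite lcE /normc sqr_sqrtr ?addr_ge0 ?sqr_ge0 // exprMn sin_pi3_sq.
by field.
Qed.

Lemma normc_ge0 z : 0 <= normc z.
Proof. by case: z => a b; exact: sqrtr_ge0. Qed.

Lemma normc_omega k : normc (omega ^+ k : C) = 1.
Proof.
elim: k => [|k IH]; first by rewrite expr0 normc1.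
rewrite exprS normcM IH mulr1 omega_lc.
have /eqP := normc_lc 0 1; rewrite mul0r addr0 expr0n expr1n add0r.
by rewrite sqrf_eq1 => /orP[/eqP //|/eqP h]; have := normc_ge0 (lc 0 1); lra.
Qed.

Lemma omega_triple j : omega ^+ (2 * j) \in [:: 1; omega ^+ 2; omega ^+ 4 : C].
Proof.
have w6 : omega ^+ 6 = 1 :> C by rewrite (exprM _ 3 2) omega3; ring.
have -> : (2 * j = 6 * (j %/ 3) + 2 * (j %% 3))%N by lia.
rewrite exprD exprM w6 expr1n mul1r.
have := ltn_mod j 3; case: (j %% 3)%N => [|[|[|//]]] _; rewrite !inE eqxx ?orbT//.
Qed.

(* The decoration of a lattice point p + q omega is p - q mod 3. *)
Lemma HexP z : Hex z <-> exists q k : int, z = lc (q + 3 * k)%:~R q%:~R.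
Proof.
have e (a b : int) : a%:~R * (2 - omega) + b%:~R * (1 + omega) =
    lc (b - a + 3 * a)%:~R (b - a)%:~R :> C.
  by rewrite /lc !rmorph_int !rmorphD rmorphN !rmorphM /=; ring.
split=> [[a [b ->]]|[q [k ->]]]; first by exists (b - a), a.
by exists k, (q + k); rewrite e addrK.
Qed.

Lemma Hex0 : Hex (0 : C).
Proof. by apply/HexP; exists 0, 0; rewrite /lc rmorph0 mul0r addr0. Qed.

Lemma HexD z w : Hex z -> Hex w -> Hex (z + w).
Proof.
move=> /HexP[q [k ->]] /HexP[q' [k' ->]]; apply/HexP; exists (q + q'), (k + k').
by rewrite lcD -!rmorphD /=; congr (lc _%:~R _); ring.
Qed.

Lemma HexN z : Hex z -> Hex (- z).
Proof.
move=> /HexP[q [k ->]]; apply/HexP; exists (- q), (- k).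
by rewrite lcN -!rmorphN /=; congr (lc _%:~R _); ring.
Qed.

Lemma Hex_rot j z : Hex z -> Hex (omega ^+ (2 * j) * z).
Proof.
move=> hz; elim: j => [|j IH]; first by rewrite muln0 expr0 mul1r.
rewrite mulnS exprD -mulrA; move: IH => /HexP[q [k ->]]; apply/HexP.
exists (q + 3 * k), (- q - 2 * k).
by rewrite omega2_lc -rmorphN -rmorphB /=; congr (lc _%:~R _); ring.
Qed.

End Eisenstein.

(** * Explicit affine form of the group generated by the rotations *)

Section Group.
Context {R : realType}.
Local Notation C := R[i].
Implicit Types (x y : R) (z w : C).

Lemma omega_inv j : omega ^+ (2 * (2 * j)) * omega ^+ (2 * j) = 1 :> C.
Proof.
rewrite -exprD; have -> : (2 * (2 * j) + 2 * j = 3 * (2 * j))%N by lia.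
by rewrite exprM omega3 exprM; have -> : (-1) ^+ 2 = 1 :> C; [ring|rewrite expr1n].
Qed.

Definition affine_group : set (C -> C) :=
  [set f | exists j h, Hex h /\ f = fun z => omega ^+ (2 * j) * z + h].

Lemma affine_group_inv j z w h :
  w = omega ^+ (2 * j) * z + h ->
  z = omega ^+ (2 * (2 * j)) * w + - (omega ^+ (2 * (2 * j)) * h).
Proof. by move=> ->; rewrite mulrDr addrK mulrA omega_inv mul1r. Qed.

Lemma affine_transformation_group : transformation_group affine_group.
Proof.
split.
- exists 0%N, 0; split; first exact: Hex0.
  by apply/funext => z; rewrite muln0 expr0 mul1r addr0.
- move=> f [j [h [_ ->]]].
  exists (fun w => omega ^+ (2 * (2 * j)) * w + - (omega ^+ (2 * (2 * j)) * h)) => z.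
    by rewrite -(@affine_group_inv j z _ h).
  by rewrite mulrDr mulrN !mulrA [omega ^+ (2 * j) * _]mulrC omega_inv !mul1r subrK.
- move=> f g [j [h [hh ->]]] [k [h' [hh' ->]]].
  exists (j + k)%N, (omega ^+ (2 * j) * h' + h); split.
    by apply: HexD => //; apply: Hex_rot.
  by apply/funext => z /=; rewrite mulnDr exprD; ring.
- move=> f g [j [h [hh ->]]] _ gK.
  exists (2 * j)%N, (- (omega ^+ (2 * (2 * j)) * h)); split.
    by apply/HexN/Hex_rot.
  by apply/funext => w; apply: affine_group_inv; rewrite gK.
Qed.

Lemma cis_2pi3 : cis (2 * pi / 3) = omega ^+ 2 :> C.
Proof. by rewrite expr2 /omega -cisD; congr cis; field. Qed.

Lemma Gamma_rotation c : vertices c -> Gamma333 (rotation c (2 * pi / 3) : C -> C).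
Proof. by move=> vc; apply: sub_gen_smallest; exists c. Qed.

(** The rotation about c is z |-> omega^2 z + (1 - omega^2) c, and for c = 0, 1, omega the constant
    is 0, 2 - omega, 1 + omega, all in [Hex]. *)
Lemma Gamma_sub_affine : @Gamma333 R `<=` affine_group.
Proof.
apply: smallest_sub affine_transformation_group _ => _ [c vc <-].
exists 1%N, ((1 - omega ^+ 2) * c); split; last first.
  by apply/funext => z; rewrite /rotation cis_2pi3 muln1; ring.
case: vc => [[->|->]|->].
- by rewrite mulr0; apply: Hex0.
- by exists 1, 0; rewrite omega2; ring.
- by exists 0, 1; rewrite mulrBl -exprSr omega3; ring.
Qed.

Lemma Gamma_comp f g : @Gamma333 R f -> Gamma333 g -> Gamma333 (f \o g).
Proof.
move=> Gf Gg A hA; case: (hA) => -[_ _ compA _] _.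
by apply: compA; [apply: Gf|apply: Gg].
Qed.

Lemma Gamma_inv f g : @Gamma333 R f -> cancel f g -> cancel g f -> Gamma333 g.
Proof.
move=> Gf fK gK A hA; case: (hA) => -[_ _ _ invA] _.
by apply: invA fK gK; apply: Gf.
Qed.

Lemma Gamma_translate z :
  Gamma333 (fun w => w + z) -> forall a : int, Gamma333 (fun w : C => w + a%:~R * z).
Proof.
move=> Gz.
have Gn (n : nat) : Gamma333 (fun w : C => w + n%:R * z).
  elim: n => [|n IH].
    have -> : (fun w => w + 0%:R * z) = id by apply/funext => w; rewrite mul0r addr0.
    by move=> A [[]].
  have -> : (fun w => w + n.+1%:R * z) = (fun w => w + z) \o (fun w => w + n%:R * z).
    by apply/funext => w /=; rewrite mulrS mulrDl mul1r addrA addrAC.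
  exact: Gamma_comp.
case=> n; first exact: (Gn n).
rewrite NegzE; apply: (Gamma_inv (Gn n.+1)) => w.
  by rewrite rmorphN mulNr addrK.
by rewrite rmorphN mulNr subrK.
Qed.

(** Conversely, multiplication by omega^4 followed by the rotation about c is the translation by (1
    - omega^2) c; c = 1 and c = omega yield the two generators of [Hex]. *)
Lemma GammaE : @Gamma333 R = affine_group.
Proof.
apply/seteqP; split; first exact: Gamma_sub_affine.
have G0 : Gamma333 (fun z : C => omega ^+ 2 * z).
  have := @Gamma_rotation 0 (or_introl (or_introl erefl)).
  by rewrite /rotation cis_2pi3; congr Gamma333; apply/funext => z; ring.
have Grot j : Gamma333 (fun z : C => omega ^+ (2 * j) * z).
  elim: j => [|j IH].
    have -> : (fun z : C => omega ^+ (2 * 0) * z) = id.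
      by apply/funext => w; rewrite muln0 mul1r.
    by move=> A [[]].
  have -> : (fun z : C => omega ^+ (2 * j.+1) * z) =
      (fun z => omega ^+ 2 * z) \o (fun z => omega ^+ (2 * j) * z).
    by apply/funext => w /=; rewrite mulnS exprD mulrA.
  exact: Gamma_comp.
have Gtr c : vertices c -> Gamma333 (fun z : C => z + (1 - omega ^+ 2) * c).
  move=> vc; have := Gamma_comp (Gamma_rotation vc) (Grot 2%N).
  congr Gamma333; apply/funext => z /=; rewrite /rotation cis_2pi3.
  by have := omega_inv 1; rewrite -exprD => w6; ring: w6.
have G1 : Gamma333 (fun z : C => z + (2 - omega)).
  have := Gtr 1 (or_introl (or_intror erefl)).
  by congr Gamma333; apply/funext => z; rewrite omega2; ring.
have G2 : Gamma333 (fun z : C => z + (1 + omega)).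
  have := Gtr omega (or_intror erefl).
  by congr Gamma333; apply/funext => z; ring: (@omega3 R).
move=> _ [j [_ [[a [b ->]] ->]]].
have := Gamma_comp (Gamma_translate G1 a) (Gamma_comp (Gamma_translate G2 b) (Grot j)).
by congr Gamma333; apply/funext => z /=; ring.
Qed.

Definition orbit z w := exists j h, Hex h /\ w = omega ^+ (2 * j) * z + h.

Lemma GammaP z w : (exists2 g, Gamma333 g & w = g z) <-> orbit z w.
Proof.
split=> [[g]|[j [h [hh ->]]]].
  by rewrite GammaE => -[j [h [hh ->]]] ->; exists j, h.
by exists (fun z => omega ^+ (2 * j) * z + h) => //; rewrite GammaE; exists j, h.
Qed.

Lemma orbit_refl z : orbit z z.
Proof. by exists 0%N, 0; split; [exact: Hex0|rewrite muln0 mul1r addr0]. Qed.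

Lemma orbit_sym z w : orbit z w -> orbit w z.
Proof.
move=> [j [h [hh /affine_group_inv e]]].
by exists (2 * j)%N, (- (omega ^+ (2 * (2 * j)) * h)); split; first exact/HexN/Hex_rot.
Qed.

Lemma orbit_trans w z u : orbit z w -> orbit w u -> orbit z u.
Proof.
move=> [j [h [hh ->]]] [k [h' [hh' ->]]].
exists (k + j)%N, (omega ^+ (2 * k) * h + h'); split.
  by apply: HexD => //; apply: Hex_rot.
by rewrite mulnDr exprD; ring.
Qed.

End Group.

(** * The two triangles as a fundamental domain, glued by the orbit relation *)

Section Domain.
Context {R : realType}.
Local Notation C := R[i].
Implicit Types (x y : R) (z w : C).

Lemma int_lt_bounds (a b p : int) : (a%:~R : R) < p%:~R -> (p%:~R : R) < b%:~R -> a < p < b.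
Proof. by rewrite !ltr_int => -> ->. Qed.

Lemma orbit_lc x y x' y' : orbit (lc x y) (lc x' y') ->
  exists q k : int,
    [\/ x' = x + q%:~R + 3 * k%:~R /\ y' = y + q%:~R,
        x' = - x - y + q%:~R + 3 * k%:~R /\ y' = x + q%:~R |
        x' = y + q%:~R + 3 * k%:~R /\ y' = - x - y + q%:~R].
Proof.
move=> [j [_ [/HexP[q [k ->]] e]]]; exists q, k; move: e.
have := @omega_triple R j; rewrite !inE => /or3P[] /eqP ->;
  rewrite ?mul1r ?omega2_lc ?omega4_lc lcD rmorphD rmorphM /= => /lc_inj[-> ->].
- by apply: Or31; rewrite addrA.
- by apply: Or32; rewrite addrA.
- by apply: Or33; rewrite addrA.
Qed.

Definition triangle x y := [/\ 0 <= x, 0 <= y & x + y <= 1].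

(** The bounds on the coordinates leave finitely many pairs (q, k) for each rotation part, and
    linear arithmetic settles each. *)
Lemma triangle_orbit x y x' y' :
  triangle x y -> triangle x' y' -> orbit (lc x y) (lc x' y') -> x = x' /\ y = y'.
Proof.
move=> [x0 y0 xy1] [x0' y0' xy1'] /orbit_lc [q [k [] [ex ey]]].
- have hq : -2 < q < 2 by apply: int_lt_bounds; lra.
  have hk : -1 < k < 1 by apply: int_lt_bounds; lra.
  have ek : k = 0 by lia.
  subst k.
  have eq : q = 0 \/ q = 1 \/ q = -1 by lia.
  by case: eq => [eq|[eq|eq]]; subst q; lra.
- have hq : -2 < q < 2 by apply: int_lt_bounds; lra.
  have hk : -1 < k < 2 by apply: int_lt_bounds; lra.
  have ek : k = 0 \/ k = 1 by lia.
  have eq : q = 0 \/ q = 1 \/ q = -1 by lia.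
  by case: ek => ek; case: eq => [eq|[eq|eq]]; subst q k; lra.
- have hq : -1 < q < 3 by apply: int_lt_bounds; lra.
  have hk : -2 < k < 1 by apply: int_lt_bounds; lra.
  have ek : k = 0 \/ k = -1 by lia.
  have eq : q = 0 \/ q = 1 \/ q = 2 by lia.
  by case: ek => ek; case: eq => [eq|[eq|eq]]; subst q k; lra.
Qed.

Definition triangle_edge x y := [\/ x = 0, y = 0 | x + y = 1].

(** The same finite search: most pairs (q, k) are contradictory, and each survivor forces equal
    coordinates and a point on an edge. *)
Lemma triangle_conj_orbit x y x' y' :
  triangle x y -> triangle x' y' -> orbit (lc x y) (lc x' y')^* ->
  [/\ x = x', y = y' & triangle_edge x y].
Proof.
move=> [x0 y0 xy1] [x0' y0' xy1']; rewrite conj_lc => /orbit_lc [q [k [] [ex ey]]].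
- have hq : -3 < q < 1 by apply: int_lt_bounds; lra.
  have hk : -1 < k < 2 by apply: int_lt_bounds; lra.
  have ek : k = 0 \/ k = 1 by lia.
  have eq : q = 0 \/ q = -2 \/ q = -1 by lia.
  case: ek => ek; case: eq => [eq|[eq|eq]]; subst q k; try by exfalso; lra.
  by split; [lra|lra|apply: Or32; lra].
  by split; [lra|lra|apply: Or31; lra].
- have hq : -3 < q < 1 by apply: int_lt_bounds; lra.
  have hk : -1 < k < 2 by apply: int_lt_bounds; lra.
  have ek : k = 0 \/ k = 1 by lia.
  have eq : q = 0 \/ q = -2 \/ q = -1 by lia.
  case: ek => ek; case: eq => [eq|[eq|eq]]; subst q k; try by exfalso; lra.
  by split; [lra|lra|apply: Or31; lra].
  by split; [lra|lra|apply: Or33; lra].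
- have hq : -2 < q < 2 by apply: int_lt_bounds; lra.
  have hk : -1 < k < 1 by apply: int_lt_bounds; lra.
  have ek : k = 0 by lia.
  subst k.
  have eq : q = 0 \/ q = 1 \/ q = -1 by lia.
  case: eq => [eq|[eq|eq]]; subst q; try by exfalso; lra.
  by split; [lra|lra|apply: Or31; lra].
  by split; [lra|lra|apply: Or32; lra].
Qed.

(** Conjugation normalizes the group: conj omega = omega^5 turns omega^(2 j) into omega^(10 j) =
    omega^(4 j), and [Hex] is stable under conjugation. *)
Lemma orbit_conj z w : orbit z w -> orbit z^* w^*.
Proof.
have [x [y ->]] := lc_surj z; move=> [j [h [/HexP[q [k ->]] ->]]].
exists (2 * j)%N, (lc (q + 3 * k)%:~R q%:~R)^*; split.
  by rewrite conj_lc; apply/HexP; exists (- q), (q + k);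
     rewrite -!rmorphN -!rmorphD /=; congr (lc _%:~R _); ring.
rewrite rmorphD rmorphM rmorphXn; congr (_ * _ + _).
have c : omega^* = omega ^+ 2 * omega ^+ 3 :> C.
  by rewrite omega3 mulrN1 omega2 omega_lc conj_lc one_lc lcB lcN; congr lc; ring.
have o6 : omega ^+ 6 = 1 :> C by rewrite (exprM _ 3 2) omega3; ring.
transitivity ((omega ^+ 2 * omega ^+ 3 : C) ^+ (2 * j)); first by congr (_ ^+ _); exact: c.
rewrite -exprD -exprM.
have -> : (5 * (2 * j) = 6 * j + 2 * (2 * j))%N by lia.
by rewrite exprD exprM o6 expr1n mul1r.
Qed.

Lemma DeltaP z : Delta z <-> exists x y, triangle x y /\ z = lc x y.
Proof.
split=> [[a [b [c [a0 b0 c0 abc ->]]]]|[x [y [[x0 y0 xy] ->]]]].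
  by exists b, c; split; [split; lra|rewrite /lc; ring].
by exists (1 - x - y), x, y; split; [lra|lra|lra|lra|rewrite /lc; ring].
Qed.

Lemma Delta_barP z : Delta_bar z <-> exists x y, triangle x y /\ z = (lc x y)^*.
Proof.
split=> [[w /DeltaP[x [y [t ->]]] <-]|[x [y [t ->]]]]; first by exists x, y.
by exists (lc x y) => //; apply/DeltaP; exists x, y.
Qed.

Lemma Delta_boundaryP x y :
  triangle x y -> Delta_boundary (lc x y) <-> triangle_edge x y.
Proof.
move=> [x0 y0 xy1].
have seg1 t : 0 + t%:C * (1 - 0) = lc t 0 :> C by rewrite real_lc; ring.
have seg2 t : 1 + t%:C * (omega - 1) = lc (1 - t) t.
  by rewrite /lc rmorphB; ring.
have seg3 t : omega + t%:C * (0 - omega) = lc 0 (1 - t).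
  by rewrite /lc rmorphB; ring.
split=> [[[]|]|[]] /=.
- by move=> [t _]; rewrite seg1 => /lc_inj[_ <-]; apply: Or32.
- by move=> [t _]; rewrite seg2 => /lc_inj[<- <-]; apply: Or33; rewrite subrK.
- by move=> [t _]; rewrite seg3 => /lc_inj[<- _]; apply: Or31.
- move=> ex; right; exists (1 - y); first by apply/andP; split; lra.
  by rewrite seg3 ex; congr lc; ring.
- move=> ey; left; left; exists x; first by apply/andP; split; lra.
  by rewrite seg1 ey.
- move=> exy; left; right; exists y; first by apply/andP; split; lra.
  by rewrite seg2; congr lc; lra.
Qed.

(** Edge by edge, a group element that conjugates the points is multiplication by omega^4, the
    identity, and the rotation of angle 2 pi / 3 about 1. *)
Lemma triangle_edge_orbit x y :
  triangle_edge x y -> orbit (lc x y) (lc x y)^*.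
Proof.
move=> h; rewrite conj_lc; case: h => h.
- exists 2%N, 0; split; first exact: Hex0.
  by rewrite omega4_lc addr0 h; congr lc; ring.
- exists 0%N, 0; split; first exact: Hex0.
  by rewrite muln0 mul1r addr0 h; congr lc; ring.
- exists 1%N, (lc (-1 + 3 * 1)%:~R (-1)%:~R); split; first by apply/HexP; exists (-1), 1.
  by rewrite omega2_lc lcD; congr lc; have -> : x = 1 - y; by [lra|ring].
Qed.

Lemma fold_sheets_lc (s : sheets R) :
  exists x y, [/\ triangle x y, fold_sheets s = lc x y &
    position s = lc x y \/ position s = (lc x y)^* ].
Proof.
case: s => z; have := set_mem (valP z).
  by move=> /DeltaP[x [y [t e]]]; exists x, y; split=> //; left.
move=> /Delta_barP[x [y [t e]]]; exists x, y; split=> //; last by right.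
by rewrite /= e conjcK.
Qed.

(** Boundary gluing is realized by the group, and [triangle_orbit] and [triangle_conj_orbit] exclude
    any further identification. *)
Lemma glue_classP (s t : sheets R) :
  glue_class s = glue_class t <-> orbit (position s) (position t).
Proof.
rewrite /glue_class; split=> [/eqmodP|st].
  rewrite /= /glue => /orP[/eqP ->|/andP[/eqP e /asboolP b]]; first exact: orbit_refl.
  have [x [y [txy e1 ps]]] := fold_sheets_lc s.
  have [x' [y' [_ e2 pt]]] := fold_sheets_lc t.
  move: b pt; rewrite -e2 -e e1 => /(Delta_boundaryP txy)/triangle_edge_orbit o.
  by case: ps => ->; case=> ->; rewrite ?conjcK //; [exact: orbit_refl|
    exact: orbit_sym|exact: orbit_refl].
apply/eqmodP; rewrite /= /glue.
case: s t st => z [] w st; have := set_mem (valP z); have := set_mem (valP w).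
- move=> /DeltaP[x [y [txy e]]] /DeltaP[x' [y' [txy' e']]].
  move: st; rewrite /= e e' => /(triangle_orbit txy' txy) [ex ey].
  by have -> : z = w; [apply: val_inj; rewrite e e' ex ey|rewrite eqxx].
- move=> /Delta_barP[x [y [txy e]]] /DeltaP[x' [y' [txy' e']]].
  move: st; rewrite /= e e' => /(triangle_conj_orbit txy' txy) [ex ey b].
  by rewrite conjcK ex ey eqxx; apply/asboolP/(Delta_boundaryP txy); rewrite -ex -ey.
- move=> /DeltaP[x [y [txy e]]] /Delta_barP[x' [y' [txy' e']]].
  move: st; rewrite /= e e' => /orbit_sym/(triangle_conj_orbit txy txy') [ex ey b].
  by rewrite conjcK ex ey eqxx; apply/asboolP/(Delta_boundaryP txy'); rewrite -ex -ey.
- move=> /Delta_barP[x [y [txy e]]] /Delta_barP[x' [y' [txy' e']]].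
  move: st; rewrite /= e e' => /orbit_conj; rewrite !conjcK => /(triangle_orbit txy' txy) [ex ey].
  by have -> : z = w; [apply: val_inj; rewrite e e' ex ey|rewrite eqxx].
Qed.

End Domain.

(** * The projection, and upper and lower bounds for the quotient metric *)

Section Metric.
Context {R : realType}.
Local Notation C := R[i].
Implicit Types (x y : R) (z w : C).

(* The decoration of a + b omega decides which vertex of Delta it is moved to. *)
Lemma to_triangle (a b : int) : exists j (h : C), Hex h /\
  forall x y, triangle (x - a%:~R) (y - b%:~R) ->
  exists x' y', triangle x' y' /\ omega ^+ (2 * j) * lc x y + h = lc x' y'.
Proof.
have [k [e|[e|e]]] : exists k, a = b + 3 * k \/ a = b + 1 + 3 * k \/ a = b + 2 + 3 * k.
  by exists ((a - b) %/ 3)%Z; lia.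
- exists 0%N, (- lc a%:~R b%:~R); split; first by apply/HexN/HexP; exists b, k; rewrite e.
  move=> x y t; exists (x - a%:~R), (y - b%:~R); split=> //.
  by rewrite muln0 mul1r lcB.
- exists 1%N, (lc (1 + a + b)%:~R (- a)%:~R); split.
    by apply/HexP; exists (- a), (b + 1 + 2 * k); congr (lc _%:~R _); lia.
  move=> x y [x0 y0 xy].
  exists (1 - (x - a%:~R) - (y - b%:~R)), (x - a%:~R); split; first by split; lra.
  by rewrite omega2_lc lcD !rmorphD rmorphN; congr lc; ring.
- exists 2%N, (lc (- b)%:~R (1 + a + b)%:~R); split.
    by apply/HexP; exists (1 + a + b), (- (b + 1 + k)); congr (lc _%:~R _); lia.
  move=> x y [x0 y0 xy].
  exists (y - b%:~R), (1 - (x - a%:~R) - (y - b%:~R)); split; first by split; lra.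
  by rewrite omega4_lc lcD !rmorphD rmorphN; congr lc; ring.
Qed.

Definition upper_sheet z (zD : Delta z) : sheets R :=
  inl (exist (fun z => z \in @Delta R) z (mem_set zD)).

Definition lower_sheet z (zD : Delta_bar z) : sheets R :=
  inr (exist (fun z => z \in @Delta_bar R) z (mem_set zD)).

(** The finite value of [sheet_dist] forces s and t onto the same sheet, so the pair z, w is
    transported into one triangle at its own distance. *)
Definition same_sheet z w := exists s t : sheets R,
  [/\ orbit z (position s), orbit w (position t) & sheet_dist s t = (normc (z - w))%:E].

(** One group element carries the whole upward triangle with corner a + b omega into [Delta],
    preserving distances; conjugation handles its mirror image in the other sheet. *)
Lemma same_sheet_triangle (a b : int) x y x' y' :
  triangle (x - a%:~R) (y - b%:~R) -> triangle (x' - a%:~R) (y' - b%:~R) ->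
  same_sheet (lc x y) (lc x' y') /\ same_sheet (lc x y)^* (lc x' y')^*.
Proof.
have [j [h [hh H]]] := to_triangle a b.
move=> /H[u [v [tuv e]]] /H[u' [v' [tuv' e']]].
have d : normc (lc u v - lc u' v') = normc (lc x y - lc x' y').
  by rewrite -e -e' opprD addrACA subrr addr0 -mulrBr normcM normc_omega mul1r.
have D : Delta (lc u v) by apply/DeltaP; exists u, v.
have D' : Delta (lc u' v') by apply/DeltaP; exists u', v'.
have o : orbit (lc x y) (lc u v) by exists j, h.
have o' : orbit (lc x' y') (lc u' v') by exists j, h.
split.
  exists (upper_sheet D), (upper_sheet D').
  by split=> //; rewrite -d.
have B : Delta_bar (lc u v)^* by exists (lc u v).
have B' : Delta_bar (lc u' v')^* by exists (lc u' v').
exists (lower_sheet B), (lower_sheet B').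
split; [exact: orbit_conj|exact: orbit_conj|].
have nJ z : normc z^* = normc z by case: z => p q; rewrite /= sqrrN.
by rewrite -rmorphB nJ -d -nJ rmorphB.
Qed.

(** Closed at both ends: a point on a tessellation line belongs to the cells on both sides. *)
Definition in_unit (k : int) x := k%:~R <= x <= k%:~R + 1.

Lemma floor_in_unit x : in_unit (Num.floor x) x.
Proof.
by rewrite /in_unit floor_le ltW // -[X in _ + X](rmorph1 (intmul 1)) -rmorphD floorD1_gt.
Qed.

(** Unit strips for x, y and x + y meet inside a single tessellation triangle, upward if c <= a + b
    and downward otherwise. *)
Lemma same_sheet_cell (a b c : int) x y x' y' :
  in_unit a x -> in_unit b y -> in_unit c (x + y) ->
  in_unit a x' -> in_unit b y' -> in_unit c (x' + y') ->
  same_sheet (lc x y) (lc x' y').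
Proof.
move=> /andP[xa xa1] /andP[yb yb1] /andP[xyc xyc1].
move=> /andP[xa' xa1'] /andP[yb' yb1'] /andP[xyc' xyc1'].
have [cab|abc] := leP c (a + b).
  have : (c%:~R : R) <= a%:~R + b%:~R by rewrite -rmorphD ler_int.
  by move=> ?; apply: (proj1 (@same_sheet_triangle a b _ _ _ _ _ _)); split; lra.
have : (a%:~R + b%:~R + 1 : R) <= c%:~R.
  by rewrite -(rmorph1 (intmul 1)) -!rmorphD ler_int; lia.
move=> ?.
(* Downward triangles are the conjugates of upward ones. *)
have conjK u v : (lc (u + v) (- v))^* = lc u v :> C.
  by rewrite conj_lc opprK addrK.
rewrite -(conjK x y) -(conjK x' y').
by apply: (proj2 (@same_sheet_triangle (a + b + 1) (- (b + 1)) _ _ _ _ _ _));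
  rewrite !(rmorphN, rmorphD) /= rmorph1; split; lra.
Qed.

Lemma same_sheet_refl z : same_sheet z z.
Proof.
have [x [y ->]] := lc_surj z.
exact: (same_sheet_cell (floor_in_unit x) (floor_in_unit y) (floor_in_unit _)
  (floor_in_unit x) (floor_in_unit y) (floor_in_unit _)).
Qed.

Lemma natprojP z : exists2 s, orbit z (position s) & natproj z = glue_class s.
Proof.
rewrite /natproj; set P := [set _ | _]; set x0 : sheets R := inl _.
exists (xget x0 P) => //.
have : P (xget x0 P).
  apply: xgetPex; have [s [_ [ oz _ _]]] := same_sheet_refl z.
  by exists s; apply/GammaP.
by move=> /GammaP.
Qed.

Lemma natproj_sheet z s : natproj z = glue_class s <-> orbit z (position s).
Proof.
have [t o ->] := natprojP z; split=> [/glue_classP ot|ot].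
  exact: orbit_trans ot.
by apply/glue_classP; apply: orbit_trans ot; apply: orbit_sym.
Qed.

Lemma natproj_eq z w : natproj z = natproj w <-> orbit z w.
Proof.
have [t o ->] := natprojP w; rewrite natproj_sheet; split=> oz.
  by apply: orbit_trans oz _; apply: orbit_sym.
exact: orbit_trans oz o.
Qed.

Definition joined (p q : Double R) (l : R) :=
  exists2 s, chain p s q & (\sum_(xy <- s) sheet_dist xy.1 xy.2 <= l%:E)%E.

Lemma joined_cat p q r l l' : joined p q l -> joined q r l' -> joined p r (l + l').
Proof.
move=> [s c sl] [s' c' sl']; exists (s ++ s').
  by elim: s p c {sl} => [p /= ->|xy s IH p /= [? ?]] //; split=> //; exact: IH.
by rewrite big_cat /= EFinD; apply: leeD.
Qed.

Lemma joined_dist p q l : joined p q l -> (double_dist p q <= l%:E)%E.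
Proof. by move=> [s c]; apply: le_trans; apply: ereal_inf_lbound; exists s. Qed.

Lemma same_sheet_joined z w :
  same_sheet z w -> joined (natproj z) (natproj w) (normc (z - w)).
Proof.
move=> [s [t [/natproj_sheet -> /natproj_sheet -> d]]].
by exists [:: (s, t)]; rewrite //= big_seq1 d.
Qed.

(** Each piece of the chain is moved by a group element so as to start where the lifted path has
    arrived; the group acts by isometries, and the triangle inequality sums up the pieces. *)
Lemma chain_lift s p q z : chain p s q -> natproj z = p ->
  exists2 w, natproj w = q &
    ((normc (z - w))%:E <= \sum_(xy <- s) sheet_dist xy.1 xy.2)%E.
Proof.
elim: s p z => [p z /= -> pz|[s t] l IH p z /= [ps c] zp].
  by exists z => //; rewrite big_nil subrr normc0.
rewrite big_cons /=.
have [w ez d] : exists2 w, natproj w = glue_class t &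
    ((normc (z - w))%:E <= sheet_dist s t)%E.
  (* A jump between sheets has infinite length, so any lift of its end will do. *)
  case: (boolP (sheet_dist s t == +oo%E)) => [/eqP ->|].
    by exists (position t); rewrite ?leey //; apply/natproj_sheet; exact: orbit_refl.
  move=> fin; have ss : sheet_dist s t = (normc (position s - position t))%:E.
    by case: s t {ps c zp} fin => u [] v.
  move: zp; rewrite -ps => /natproj_sheet/orbit_sym[j [h [hh e]]].
  exists (omega ^+ (2 * j) * position t + h).
    by apply/natproj_sheet/orbit_sym; exists j, h.
  rewrite ss lee_fin e opprD addrACA subrr addr0 -mulrBr normcM normc_omega.
  by rewrite mul1r.
have [u eu du] := IH _ _ c ez.
exists u => //; apply: le_trans (leeD d du).
rewrite -EFinD lee_fin; have -> : z - u = (z - w) + (w - u) by ring.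
exact: le_normcD.
Qed.

Lemma double_dist_lb z w r :
  (forall u, orbit w u -> r <= normc (z - u)) ->
  (r%:E <= double_dist (natproj z) (natproj w))%E.
Proof.
move=> H; apply/ereal_infP => _ [s c <-].
have [u /esym/natproj_eq/H ru] := chain_lift c erefl.
by apply: le_trans; rewrite lee_fin.
Qed.

End Metric.

Section Line.
Context {R : realType}.
Local Notation C := R[i].
Implicit Types (x y s t : R) (z w : C).

Lemma lc00 : lc 0 0 = 0 :> C.
Proof. by rewrite /lc rmorph0 mul0r addr0. Qed.

Lemma normc_lattice_ge1 (p q : int) :
  lc p%:~R q%:~R != 0 :> C -> 1 <= normc (lc p%:~R q%:~R : C).
Proof.
move=> nz; rewrite -(@ler_pXn2r _ 2) ?nnegrE ?normc_ge0 // expr1n normc_lc.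
rewrite -!rmorphXn -!rmorphM -!rmorphD /= -(rmorph1 (intmul 1)) ler_int.
suff : p <> 0 \/ q <> 0 by move=> ?; nia.
have [p0|] := eqVneq p 0; last by left; apply/eqP.
have [q0|] := eqVneq q 0; last by right; apply/eqP.
by move: nz; rewrite p0 q0 lc00 eqxx.
Qed.

(** Area of a parallelogram against the product of its sides: the gap between the squares is the
    square of the real inner product. *)
Lemma normc_det_le x y x' y' :
  3 / 4 * (x * y' - y * x') ^+ 2 <= (normc (lc x y) * normc (lc x' y')) ^+ 2.
Proof.
rewrite exprMn !normc_lc -subr_ge0.
have -> : (x ^+ 2 + x * y + y ^+ 2) * (x' ^+ 2 + x' * y' + y' ^+ 2) -
   3 / 4 * (x * y' - y * x') ^+ 2 =
   (x * x' + y * y' + (x * y' + y * x') / 2) ^+ 2 by field.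
exact: sqr_ge0.
Qed.

(** If B < d, then A <= F A < 2 d, whence A w < 2 d w <= 1 / 4. In use, w is the speed, F = |1 -
    zeta| for a rotation part zeta, A the distance to its centre and d the displacement along the
    line. *)
Lemma far_dist_le (F A B d w : R) :
  w * d <= 1 / 8 -> 1 <= w -> 1 <= F ^+ 2 -> 0 <= F -> 1 / 4 <= A * w ->
  F * A <= B + d -> d <= B.
Proof.
move=> small w1 F1 F0 Aw FA; rewrite leNgt; apply/negP => Bd.
have w0 := lt_le_trans ltr01 w1.
have {}F1 : 1 <= F by nra.
have A0 : 0 <= A by rewrite -(pmulr_lge0 _ w0); lra.
have AF : A <= F * A by rewrite ler_peMl.
have : A * w < 2 * d * w by rewrite ltr_pM2r //; lra.
lra.
Qed.

Definition grid (N : int) (f : R -> R) :=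
  forall (k : int) t, f t = k%:~R -> exists j : int, N%:~R * t = j%:~R.

(* An integer strictly between the values at s and t would be the value at a
   multiple of 1 / N interior to [j / N, (j + 1) / N]. *)
Lemma affine_in_unit (N : int) (a b : R) (j : int) s t :
  0 < N -> (b = 0) \/ grid N (fun t => a + t * b) ->
  s <= t -> j%:~R <= N%:~R * s -> N%:~R * t <= j%:~R + 1 ->
  exists k, in_unit k (a + s * b) /\ in_unit k (a + t * b).
Proof.
move=> N0 g st js tj.
have N0' : 0 < (N%:~R : R) by rewrite ltr0z.
have [b0|b0] := eqVneq b 0.
  by exists (Num.floor a); rewrite b0 !mulr0 addr0; split; exact: floor_in_unit.
case: g => [/eqP|g]; first by rewrite (negbTE b0).
have nocross (k : int) : Num.min (a + s * b) (a + t * b) < k%:~R ->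
    k%:~R < Num.max (a + s * b) (a + t * b) -> False.
  move=> lo hi; pose u := (k%:~R - a) / b.
  have eu : a + u * b = k%:~R by rewrite /u divfK // addrC subrK.
  have [i ei] := g _ _ eu.
  have su : s < u < t.
    move: lo hi; rewrite -eu gt_min lt_max => /orP lo /orP hi.
    have [bp|bn] := ltP 0 b.
      have sb : s * b <= t * b by rewrite ler_pM2r.
      by apply/andP; split; rewrite -(ltr_pM2r bp); lra.
    have {b0}bn : b < 0 by rewrite lt_neqAle b0.
    have sb : t * b <= s * b by rewrite ler_nM2r.
    by apply/andP; split; rewrite -(ltr_nM2r bn); lra.
  move/andP: su => [su ut].
  have : j < i < j + 1.
    by apply: (@int_lt_bounds R); rewrite -ei ?rmorphD /=; nra.
  lia.
have := floor_in_unit (Num.min (a + s * b) (a + t * b)).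
set k := Num.floor _ => /andP[k1 k2].
exists k.
have k3 : Num.max (a + s * b) (a + t * b) <= k%:~R + 1.
  rewrite leNgt; apply/negP; rewrite -[X in _ + X](rmorph1 (intmul 1)) -rmorphD => h.
  apply: (nocross _ _ h).
  exact: floorD1_gt.
move: k1 k3; rewrite le_min ge_max => /andP[? ?] /andP[? ?].
by rewrite /in_unit; split; apply/andP.
Qed.

Variables (m n : int).
Hypothesis n_odd : odd `|n|%N.
Let v : R := normc (lc m%:~R n%:~R : C).

Definition line t : C := lc (1 / 2 + t * m%:~R) (t * n%:~R).

Lemma lineB s t : line s - line t = (s - t)%:C * lc m%:~R n%:~R.
Proof. by rewrite /line lcB real_lc lcM; congr lc; ring. Qed.

Lemma normc_lineB s t : normc (line s - line t) = v * `|s - t|.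
Proof.
rewrite lineB normcM mulrC; congr (_ * _).
by rewrite /= expr0n addr0 sqrtr_sqr.
Qed.

Lemma speed_ge1 : 1 <= v.
Proof.
apply: normc_lattice_ge1; apply/eqP => e.
have := @lc_inj R m%:~R n%:~R 0 0; rewrite e lc00.
by case=> // _ /eqP; rewrite intr_eq0 => /eqP n0; move: n_odd; rewrite n0.
Qed.

(** Twice the determinant of the difference against omega0 is n - 2 p n + 2 q m, whatever t is; it
    is odd, hence nonzero, so the area bound gives at least sqrt 3 / 4. *)
Lemma line_lattice_far (p q : int) t : 1 / 4 <= normc (line t - lc p%:~R q%:~R) * v.
Proof.
have h := normc_det_le (1 / 2 + t * m%:~R - p%:~R) (t * n%:~R - q%:~R) m%:~R n%:~R.
have D : 1 <= (n - 2 * p * n + 2 * q * m) ^+ 2 by nia.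
have {}D : (1 : R) <= (n%:~R - 2 * p%:~R * n%:~R + 2 * q%:~R * m%:~R) ^+ 2.
  have := D; rewrite -(ler_int R) => /le_trans; apply.
  by rewrite rmorphXn !(rmorphD, rmorphN, rmorphM).
have q0 : 0 <= 1 / 4 :> R by lra.
rewrite -(@ler_pXn2r _ 2) ?nnegrE ?mulr_ge0 ?normc_ge0 //.
rewrite lcB; apply: le_trans h.
have -> : (1 / 2 + t * m%:~R - p%:~R) * n%:~R - (t * n%:~R - q%:~R) * m%:~R =
  (n%:~R - 2 * p%:~R * n%:~R + 2 * q%:~R * m%:~R) / 2 :> R by field.
move: D; set d := (_ + _ : R) => D; rewrite expr_div_n; nra.
Qed.

Lemma line_nonlattice (p q : int) t : line t <> lc p%:~R q%:~R.
Proof.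
move=> e; have := line_lattice_far p q t.
by rewrite e subrr normc0 mul0r; lra.
Qed.

(* A rotation z |-> zeta z + h in the group fixes the lattice point h / (1 - zeta),
   because Hex = (1 - omega^2) Lambda = (1 - omega^4) Lambda. *)
Lemma line_orbit_dist s t u :
  v * (v * `|s - t|) <= 1 / 8 -> orbit (line t) u ->
  v * `|s - t| <= normc (line s - u).
Proof.
have v1 := speed_ge1.
rewrite -normc_lineB => small [j [h [/HexP[q [k ->]] ->]]].
set d := normc _ in small *; have d0 : 0 <= d := normc_ge0 _.
have d8 : d <= 1 / 8 by nra.
have tri (a b c : C) : normc c = d -> a = b + c -> normc a <= normc b + d.
  by move=> <- ->; exact: le_normcD.
(* For a rotation part zeta, f is 1 - zeta, the centre is p' + q' omega, and c is zeta (line t -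
   line s), of norm d. *)
have far (f : C) (p' q' : int) c : 1 <= normc f ^+ 2 -> normc c = d ->
    f * (line s - lc p'%:~R q'%:~R) =
      line s - (omega ^+ (2 * j) * line t + lc (q + 3 * k)%:~R q%:~R) + c ->
  d <= normc (line s - (omega ^+ (2 * j) * line t + lc (q + 3 * k)%:~R q%:~R)).
  move=> f1 cd /(tri _ _ _ cd); rewrite normcM.
  exact: far_dist_le small v1 f1 (normc_ge0 f) (line_lattice_far p' q' s).
have := @omega_triple R j; rewrite !inE => /or3P[] /eqP e; rewrite e in far *.
(* Translation by a nonzero g moves points by at least 1, and 1 - d >= d since d <= 1 / 8. *)
- rewrite mul1r; set g := lc _ _.
  have [->|/normc_lattice_ge1] := eqVneq g 0; first by rewrite addr0.
  suff : normc g <= normc (line s - (line t + g)) + d by rewrite -/g; lra.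
  rewrite -[in leRHS]normcN; apply: (tri _ _ (line s - line t)) => //.
  by rewrite /=; ring.
(* The centre is h / (2 - omega) = k + (q + k) omega; in the next case it is h / (1 + omega). *)
- apply: (far (1 - omega ^+ 2) k (q + k) (omega ^+ 2 * (line t - line s))).
  + by rewrite omega2 one_lc omega_lc !lcB normc_lc; lra.
  + by rewrite normcM normc_omega mul1r -normcN opprB.
  rewrite /lc !rmorph_int !(rmorphD, rmorphN, rmorphM) /=.
  by ring: (@omega2 R).
- apply: (far (1 - omega ^+ 4) (q + 2 * k) (- k) (omega ^+ 4 * (line t - line s))).
  + by rewrite omega4 opprK one_lc omega_lc lcD normc_lc; lra.
  + by rewrite normcM normc_omega mul1r -normcN opprB.
  rewrite omega4 /lc !rmorph_int !(rmorphD, rmorphN, rmorphM) /=.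
  by ring: (@omega2 R).
Qed.

End Line.

(** The Lipschitz bound telescopes over every partition; a uniform partition of mesh below the
    common radius e attains it. *)
Lemma curve_length_locally_isometric (R : realType) (a b v e : R) (gamma : R -> Double R) :
  a <= b -> 0 < e ->
  (forall s t, s <= t -> (double_dist (gamma s) (gamma t) <= (v * (t - s))%:E)%E) ->
  (forall s t, `|s - t| < e -> double_dist (gamma s) (gamma t) = (v * `|s - t|)%:E) ->
  curve_length a b gamma = (v * (b - a))%:E.
Proof.
move=> ab e0 lip iso.
have tele s : itv_partition a b s ->
    \sum_(0 <= k < size s) v * (nth b (a :: s) k.+1 - nth b (a :: s) k) = v * (b - a).
  move=> [_ /eqP sb]; rewrite -mulr_sumr telescope_sumr //.
  by congr (_ * (_ - _)); rewrite -[RHS]sb (last_nth b).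
apply/eqP; rewrite eq_le; apply/andP; split.
  apply: ge_ereal_sup => _ [s hs <-]; rewrite -(tele s hs) -sumEFin.
  rewrite big_nat [leRHS]big_nat; apply: lee_sum => k /andP[_ ks]; apply: lip.
  apply/ltW; case: hs => /(pathP b) /(_ k ks) //.
have [K Kgt0 hK] : exists2 K, (0 < K)%N & (b - a) / e < K%:R.
  by exists (Num.truncn ((b - a) / e)).+1 => //; exact: truncnS_gt.
have [eab|nab] := eqVneq a b.
  apply: ereal_sup_ubound; exists [::]; last by rewrite big_nil eab subrr mulr0.
  by split=> //=; rewrite eab.
have K0 : 0 < K%:R :> R by rewrite ltr0n.
pose p (i : nat) := a + (b - a) * (i%:R / K%:R).
have dp i : p i.+1 - p i = (b - a) / K%:R.
  by rewrite /p -natr1; field; rewrite gt_eqF.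
have ab' : 0 < b - a by rewrite subr_gt0 lt_neqAle nab.
have dp0 : 0 < (b - a) / K%:R by rewrite divr_gt0.
have dpe : (b - a) / K%:R < e.
  by rewrite ltr_pdivrMr // mulrC -ltr_pdivrMr.
have nthp k : (k <= K)%N -> nth b (a :: [seq p i | i <- iota 1 K]) k = p k.
  case: k => [_|k kK] /=; first by rewrite /p mul0r mulr0 addr0.
  by rewrite (nth_map 0%N) ?size_iota // nth_iota.
have part : itv_partition a b [seq p i | i <- iota 1 K].
  split.
    apply/(pathP b) => i; rewrite size_map size_iota => iK.
    rewrite (nthp i (ltnW iK)); have := nthp i.+1 iK; rewrite /= => ->.
    by rewrite -subr_gt0 dp.
  rewrite (last_nth b) size_map size_iota nthp //.
  by rewrite /p divff ?(lt0r_neq0 K0) // mulr1 addrC subrK.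
apply: ereal_sup_ubound; exists [seq p i | i <- iota 1 K] => //.
rewrite -(tele _ part) -sumEFin big_nat [RHS]big_nat.
apply: eq_bigr => k; rewrite size_map size_iota => /andP[_ kK].
rewrite (nthp k (ltnW kK)) (nthp k.+1 kK) iso distrC dp ?gtr0_norm //.
Qed.

(** * The projected line: geodesicity, length and periods *)

Section Geodesic.
Context {R : realType}.
Local Notation C := R[i].
Implicit Types (x y s t : R) (z w : C).
Variables (m n : int).
Hypothesis n_odd : odd `|n|%N.
Let v : R := normc (lc m%:~R n%:~R : C).
Let L := @line R m n.

Lemma grid_affine (e b c : int) :
  grid (2 * b * c) (fun t : R => e%:~R / 2 + t * b%:~R).
Proof.
move=> k t ek; exists (c * (2 * k - e)).
by rewrite !(rmorphM, rmorphB) /= -ek; field.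
Qed.

Lemma line_joined s t : s <= t -> joined (natproj (L s)) (natproj (L t)) (v * (t - s)).
Proof.
(* The line meets the lines of the tessellation, where one of the coordinates
   x, y, x + y is an integer, only at multiples of 1 / N; nz removes the factors
   of the families to which the line is parallel. *)
pose nz (i : int) := if i == 0 then 1 else i.
have nz0 i : nz i != 0 by rewrite /nz; case: ifP => // ->.
(* Squaring makes N positive whatever the signs and keeps it a multiple of 2 b for each nonzero b
   among m, n, m + n. *)
pose N := (2 * nz m * nz n * nz (m + n)) ^+ 2.
have N0 : 0 < N by rewrite lt_neqAle sqr_ge0 eq_sym expf_neq0 // !mulf_neq0.
have dvN b : b \in [:: m; n; m + n] -> b = 0 \/ exists c, N = 2 * b * c.
  have [->|b0 bi] := eqVneq b 0; [by left|right].
  have nzb : nz b = b by rewrite /nz (negbTE b0).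
  move: bi; rewrite /N !inE => /or3P[] /eqP <-; rewrite nzb.
  - by exists (2 * b * (nz n * nz (b + n)) ^+ 2); ring.
  - by exists (2 * b * (nz m * nz (m + b)) ^+ 2); ring.
  - by exists (2 * b * (nz m * nz n) ^+ 2); ring.
have gr e b : b \in [:: m; n; m + n] ->
    (b%:~R = 0 :> R) \/ grid N (fun t : R => e%:~R / 2 + t * b%:~R).
  move=> /dvN[->|[c ->]]; [by left|right; exact: grid_affine].
(* Between consecutive multiples of 1 / N the line stays in one closed triangle, so a single chain
   link suffices. *)
have cell j s' t' : s' <= t' -> j%:~R <= N%:~R * s' -> N%:~R * t' <= j%:~R + 1 ->
    joined (natproj (L s')) (natproj (L t')) (v * (t' - s')).
  move=> st js tj.
  have au e b bi := affine_in_unit N0 (gr e b bi) st js tj.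
  have [k1 [s1 t1]] := au 1 m (mem_head _ _).
  have [k2 [s2 t2]] : exists k, in_unit k (s' * n%:~R) /\ in_unit k (t' * n%:~R).
    have [|k] := au 0 n; first by rewrite !inE eqxx orbT.
    by rewrite !mul0r !add0r; exists k.
  have [k3 [s3 t3]] : exists k, in_unit k (1 / 2 + s' * m%:~R + s' * n%:~R) /\
      in_unit k (1 / 2 + t' * m%:~R + t' * n%:~R).
    have [|k] := au 1 (m + n); first by rewrite !inE eqxx !orbT.
    by rewrite rmorphD /= !mulrDr !addrA; exists k.
  have -> : v * (t' - s') = normc (L s' - L t').
    by rewrite normc_lineB distrC ger0_norm ?subr_ge0.
  exact: same_sheet_joined (same_sheet_cell s1 s2 s3 t1 t2 t3).
have N0' : 0 < (N%:~R : R) by rewrite ltr0z.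
have fl (r : R) := floor_in_unit r.
move=> st; have [d] : exists d : nat, Num.floor (N%:~R * t) <= Num.floor (N%:~R * s) + d%:Z.
  by exists `|Num.floor (N%:~R * t) - Num.floor (N%:~R * s)|%N; lia.
(* Induction on a bound for the grid steps from s to t; u below is the first multiple of 1 / N after
   s. *)
elim: d s st => [|d IH] s st fd.
  apply: (cell (Num.floor (N%:~R * s))) => //; first by have /andP[] := fl (N%:~R * s).
  have /andP[_ /le_trans] := fl (N%:~R * t); apply.
  by rewrite lerD2r ler_int; lia.
pose j := Num.floor (N%:~R * s).
have /andP[js sj] := fl (N%:~R * s); rewrite -/j in js sj.
have [tj|tj] := leP (N%:~R * t) (j%:~R + 1); first exact: (cell j).
pose u : R := (j%:~R + 1) / N%:~R.
have Nu : N%:~R * u = j%:~R + 1 by rewrite mulrC divfK ?gt_eqF.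
have su : s <= u by rewrite ler_pdivlMr // mulrC.
have ut : u <= t by rewrite ler_pdivrMr // mulrC ltW.
have -> : v * (t - s) = v * (u - s) + v * (t - u) by ring.
apply: joined_cat (cell j _ _ su js _) (IH _ ut _); first by rewrite Nu.
have -> : Num.floor (N%:~R * u) = j + 1; last by move: fd; rewrite -/j; lia.
by rewrite Nu -[X in _ + X](rmorph1 (intmul 1)) -rmorphD /= intrKfloor.
Qed.

Lemma dist_line_le s t :
  s <= t -> (double_dist (natproj (L s)) (natproj (L t)) <= (v * (t - s))%:E)%E.
Proof. by move=> /line_joined; exact: joined_dist. Qed.

Lemma dist_line_ge s t : v * (v * `|s - t|) <= 1 / 8 ->
  ((v * `|s - t|)%:E <= double_dist (natproj (L s)) (natproj (L t)))%E.
Proof. by move=> h; apply: double_dist_lb => u; exact: line_orbit_dist. Qed.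

Lemma double_dist_sym p q : @double_dist R p q = double_dist q p.
Proof.
suff le p' q' : (@double_dist R p' q' <= double_dist q' p')%E by apply: le_anti; rewrite !le.
apply/ereal_infP => _ [s c <-]; apply: ereal_inf_lbound.
exists [seq (xy.2, xy.1) | xy <- rev s].
  elim: s q' c => [r /= ->//|[x y] s IH r /= [rx /IH]].
  rewrite rev_cons map_rcons; move: [seq _ | _ <- _] => l.
  by elim: l p' {IH} => [p1 /= -> //|z l IH p1 /= [? /IH]].
rewrite big_map; have -> : (\sum_(j <- rev s) sheet_dist j.2 j.1 =
    \sum_(j <- rev s) sheet_dist j.1 j.2)%E.
  apply: eq_bigr => -[[x|x] [y|y]] _ //=; by rewrite -normcN opprB.
by apply: perm_big; rewrite perm_rev.
Qed.

Lemma dist_line s t : v * (v * `|s - t|) <= 1 / 8 ->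
  double_dist (natproj (L s)) (natproj (L t)) = (v * `|s - t|)%:E.
Proof.
move=> h; apply/eqP; rewrite eq_le dist_line_ge // andbT.
have [st|/ltW ts] := leP s t.
  by rewrite distrC ger0_norm ?subr_ge0 // dist_line_le.
by rewrite double_dist_sym ger0_norm ?subr_ge0 // dist_line_le.
Qed.

Let v0 : 0 < v.
Proof. exact: lt_le_trans ltr01 (@speed_ge1 R m n n_odd). Qed.

(** Chosen so that v^2 r = 1 / 8, the smallness that [line_orbit_dist] asks for; one radius serves
    every t. *)
Definition isometry_radius : R := 1 / (8 * v ^+ 2).

Lemma isometry_radius_gt0 : 0 < isometry_radius.
Proof. by rewrite divr_gt0 // mulr_gt0 // exprn_gt0. Qed.

Lemma lt_isometry_radius s t : `|s - t| < isometry_radius -> v * (v * `|s - t|) <= 1 / 8.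
Proof.
have e : v * (v * isometry_radius) = 1 / 8.
  by rewrite /isometry_radius; field; rewrite gt_eqF.
by move=> /ltW h; rewrite -e !ler_pM2l.
Qed.

(** Cone points have lattice points as representatives, whose orbits stay in the lattice, and the
    line avoids the lattice. *)
Lemma line_not_cone t : ~ cone_point (natproj (L t)).
Proof.
move=> [x]; have [a [b [_ fx px]]] := fold_sheets_lc x.
rewrite /= fx => vx /esym/natproj_sheet/orbit_sym.
have [p [q ->]] : exists p q : int, position x = lc p%:~R q%:~R.
  have [p [q e]] : exists p q : int, lc a b = lc p%:~R q%:~R.
    case: vx => [[|]|] ->; [exists 0, 0|exists 1, 0|exists 0, 1].
    - by rewrite lc00.
    - by rewrite one_lc.
    - by rewrite omega_lc.
  case: px => ->; first by exists p, q.
  by exists (p + q), (- q); rewrite e conj_lc rmorphD rmorphN.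
move=> /orbit_lc [i [k [] [ex ey]]].
- apply: (@line_nonlattice R m n n_odd (p + i + 3 * k) (q + i) t).
  by rewrite /line ex ey !(rmorphD, rmorphM).
- apply: (@line_nonlattice R m n n_odd (- p - q + i + 3 * k) (p + i) t).
  by rewrite /line ex ey !(rmorphD, rmorphM, rmorphN).
- apply: (@line_nonlattice R m n n_odd (q + i + 3 * k) (- p - q + i) t).
  by rewrite /line ex ey !(rmorphD, rmorphM, rmorphN).
Qed.

Lemma line_geodesic : geodesic (fun t => natproj (L t)).
Proof.
split; first exact: line_not_cone.
(* Two parameters within half the radius of t are within the radius of each other. *)
exists v => // t; exists (isometry_radius / 2); first by rewrite divr_gt0 // isometry_radius_gt0.
move=> s s' hs hs'; apply: dist_line; apply: lt_isometry_radius.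
have -> : s - s' = (s - t) - (s' - t) by ring.
by apply: le_lt_trans (ler_normB _ _) _; lra.
Qed.

Lemma line_length T : 0 <= T -> curve_length 0 T (fun t => natproj (L t)) = (v * T)%:E.
Proof.
move=> T0.
have := @curve_length_locally_isometric R 0 T v isometry_radius (fun t => natproj (L t)) T0
  isometry_radius_gt0 dist_line_le.
rewrite subr0; apply => s t /lt_isometry_radius; exact: dist_line.
Qed.

Lemma line_period T t : Hex (T%:C * lc m%:~R n%:~R : C) -> natproj (L (t + T)) = natproj (L t).
Proof.
move=> h; apply/natproj_eq/orbit_sym; exists 0%N, (T%:C * lc m%:~R n%:~R); split=> //.
rewrite muln0 mul1r real_lc lcM /L /line lcD; congr lc; ring.
Qed.

(* At t = 1 / (12 k) the point of the orbit can only be reached by a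
   translation: a rotation would force 4 to divide n. *)
Lemma line_shift (T k : int) : 0 < k ->
  orbit (L (1 / (12 * k%:~R))) (L (1 / (12 * k%:~R) + T%:~R / k%:~R)) ->
  exists q i : int, T * m = k * (q + 3 * i) /\ T * n = k * q.
Proof.
move=> k0; have k0' : (k%:~R : R) != 0 by rewrite intr_eq0 gt_eqF.
have : k%:~R * (1 / (12 * k%:~R)) = 1 / 12 :> R by field.
have : k%:~R * (T%:~R / k%:~R) = T%:~R :> R by field.
move: (1 / _) (T%:~R / _) => t c kc kt /orbit_lc[q [i [] [ex ey]]].
- exists q, i; split; apply/eqP; rewrite -(eqr_int R) !(rmorphM, rmorphD) /= -kc; apply/eqP.
    by rewrite -mulrA; congr (_ * _); lra.
  by rewrite -mulrA; congr (_ * _); lra.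
(* Eliminating t m from the two equations leaves 3 t n; multiplied by 4 k, with 12 k t = 1 and k c =
   T, it makes n a multiple of 4. The other rotation is alike. *)
- have : n = 4 * (k * (2 * q + (q + 3 * i)) - T * (2 * n + m)).
    apply/eqP; rewrite -(eqr_int R) !(rmorphM, rmorphD, rmorphN) /= -kc; apply/eqP.
    have e : 3 * (t * n%:~R) = 3 * q%:~R + 3 * i%:~R - c * (2 * n%:~R + m%:~R) by lra.
    transitivity (12 * (k%:~R * t) * n%:~R); first by rewrite kt; field.
    transitivity (4 * k%:~R * (3 * (t * n%:~R))); first by ring.
    by rewrite e; ring.
  by move: n_odd; lia.
- have : n = 4 * (k * (q - (q + 3 * i)) - T * (n - m)).
    apply/eqP; rewrite -(eqr_int R) !(rmorphM, rmorphD, rmorphN) /= -kc; apply/eqP.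
    have e : 3 * (t * n%:~R) = - 3 * i%:~R - c * (n%:~R - m%:~R) by lra.
    transitivity (12 * (k%:~R * t) * n%:~R); first by rewrite kt; field.
    transitivity (4 * k%:~R * (3 * (t * n%:~R))); first by ring.
    by rewrite e; ring.
  by move: n_odd; lia.
Qed.

(** A k-th iterate has period T / k; [line_shift] then puts (T / k) omega0 in [Hex], which the last
    hypothesis excludes for k > 1. *)
Lemma line_primitive (T : int) : 0 < T ->
  Hex (T%:~R * lc m%:~R n%:~R : C) ->
  (forall k q i : int, 1 < k -> T * m = k * (q + 3 * i) -> T * n = k * q -> False) ->
  primitive_closed_geodesic (T%:~R : R) (fun t => natproj (L t)).
Proof.
move=> T0 hT prim; split.
  split; [by rewrite ltr0z|exact: line_geodesic|move=> t; apply: line_period].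
  by rewrite rmorph_int.
move=> [k [S [sigma [k1 [_ _ perS] it]]]].
have k0 : (k%:R : R) != 0 by rewrite pnatr_eq0 -lt0n ltnW.
have T0' : (T%:~R : R) != 0 by rewrite intr_eq0 gt_eqF.
have : natproj (L (1 / (12 * k%:R))) = natproj (L (1 / (12 * k%:R) + T%:~R / k%:R)).
  rewrite !it -[LHS]perS; congr sigma; field.
  by rewrite T0' k0.
move=> /natproj_eq /(@line_shift T k%:Z) [|q [i [e1 e2]]]; first by lia.
by apply: (prim k%:Z q i); first lia.
Qed.

End Geodesic.

(** * Minimality of the period 1 or 3 from the coprimality of m and n *)

Theorem corollary6 (R : realType) (m n : int) :
  coprimez m n -> odd `|n|%N ->
  let omega0 : R[i] := m%:~R + n%:~R * omega in
  let gamma : R -> Double R := fun t => natproj (1 / 2 + t%:C * omega0) in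
  let T : R := if omega0 \in @Hex R then 1 else 3 in
  primitive_closed_geodesic T gamma /\
  curve_length 0 T gamma =
    (if omega0 \in @Hex R then normc omega0 else 3 * normc omega0)%:E.
Proof.
move=> cop n_odd omega0 gamma T.
have e0 : omega0 = lc m%:~R n%:~R by rewrite /lc !rmorph_int.
have -> : gamma = fun t => natproj (line m n t).
  apply/funext => t; rewrite /gamma e0 /line; congr natproj.
  rewrite real_lc lcM (_ : 1 / 2 = lc (1 / 2) 0) ?lcD; last first.
    by rewrite -real_lc rmorphM fmorphV rmorph1 rmorph_nat.
  by congr lc; ring.
have [u [w uw]] : exists u w : int, u * m + w * n = 1.
  by case/coprimezP: cop => -[u w] e; exists u, w.
have HexT (c : int) : c%:~R * lc m%:~R n%:~R = lc (c * m)%:~R (c * n)%:~R :> R[i].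
  by rewrite /lc !rmorph_int !rmorphM /=; ring.
rewrite /T; case: ifPn => [|]; rewrite e0.
  rewrite inE => hex; split; last by rewrite line_length // mulr1.
  apply: (line_primitive n_odd (T := 1)) => //; first by rewrite mul1r.
  move=> k q i k1 em en.
  (* By Bezout k divides u m + w n = 1, against k > 1. *)
  have : k * (u * (q + 3 * i) + w * q) = 1.
    by rewrite mulrDr 2!(mulrCA k) -em -en; lia.
  move: (_ + w * _) => X kX.
  have [X0|X0] := leP X 0; nia.
move=> nhex; split; last by rewrite line_length // mulrC.
apply: (line_primitive n_odd (T := 3)) => //.
  (* Three times any lattice point lies in [Hex]: 3 m = 3 n + 3 (m - n). *)
  rewrite (HexT 3); apply/HexP; exists (3 * n), (m - n).
  by congr (lc _%:~R _); ring.
move=> k q i k1 em en.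
(* Here k divides 3, so k = 3, and omega0 = (q + 3 i) + q omega would itself be in [Hex]. *)
have k3 : k * (u * (q + 3 * i) + w * q) = 3.
  by rewrite mulrDr 2!(mulrCA k) -em -en; lia.
have k3' : k = 3.
  move: (_ + w * _) k3 => X kX.
  have X0 : 0 < X by nia.
  have X1 : X = 1 by nia.
  by move: kX; rewrite X1 mulr1.
move: nhex; rewrite notin_setE; apply; apply/HexP; exists q, i.
by congr lc; congr (_%:~R); lia.
Qed.
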